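(* Let $K,s,N$ be positive integers, $M=Ks$, $M\ge N\ge s$, $0<\delta<1$, $\epsilon=(1+\delta)^3-1$, and let $\{x_i\}_{i=1}^M$ be independent random vectors in $\mathbb R^N$ that are uniformly distributed on the unit sphere. Let $\{J_k\}_{k=1}^K$ be a partition of the index set $\{1,\dots,M\}$ into sets of size $s$, and for each $k$ let $P_k$ be the orthogonal projection onto the span of $\{x_i\}_{i\in J_k}$. Then for fixed $k\ne l$, $$\mathbb P\left(\frac1{1+\epsilon}-\epsilon\sqrt{\frac{(1+\epsilon)N}{s}}\le\frac{N}{s^2}\operatorname{tr}[P_lP_k]\le 1+\epsilon\left(1+\sqrt{\frac{(1+\epsilon)N}{s}}\right)+\frac{N\epsilon^2}{4s}\right)\ge 1-R_1-R_2,$$ where $$R_1=2s\,e^{(1+\delta)s/2-s(s-1)(\delta^2/2-\delta^3/3)/2}$$ and $$R_2=2\left(M+K\left(1+\frac4\delta\right)^s\right)e^{-N\delta^2/4+N\delta^3/3}+2\left(1+\frac4\delta\right)^N e^{-M\delta^2/4+M\delta^3/3}.$$ *)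

(* Defs.v *)
(* MathComp-Analysis: real numbers are an arbitrary [R : realType]. *)
From mathcomp Require Import all_boot all_order all_algebra.
From mathcomp Require Import all_classical all_reals all_analysis.

Set Implicit Arguments.
Unset Strict Implicit.
Unset Printing Implicit Defensive.

Import Order.TTheory GRing.Theory Num.Theory.
Import numFieldNormedType.Exports.

Local Open Scope classical_set_scope.
Local Open Scope ring_scope.

(* R^N with its Borel sigma-algebra; convertible to 'rV[R]_N.  The topology on
   row vectors comes from the sup norm, hence is the Euclidean one. *)
Definition borel_rV (R : realType) (N : nat) :=
  g_sigma_algebraType (@open 'rV[R]_N).

(* The norm of 'rV[R]_N in the library is the sup norm, so the Euclidean sphere
   is written out. *)
Definition unit_sphere (R : realType) (N : nat) : set (borel_rV R N) :=
  [set v : 'rV[R]_N | \sum_(j < N) v ord0 j ^+ 2 = 1].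

(* The uniform distribution on the sphere: the rotation-invariant Borel
   probability measure carried by it. *)
Definition uniform_on_sphere (R : realType) (N : nat)
    (mu : set (borel_rV R N) -> \bar R) : Prop :=
  mu (@unit_sphere R N) = 1%E /\
  forall Q : 'M[R]_N, Q *m Q^T = 1%:M ->
  forall A : set (borel_rV R N), measurable A ->
    mu [set v : 'rV[R]_N | A (v *m Q)] = mu A.

Definition mutually_independent (R : realType) (d d' : measure_display)
    (T : measurableType d) (T' : measurableType d') (P : probability T R)
    (I : finType) (X : I -> {RV P >-> T'}) : Prop :=
  forall (J : {set I}) (B : I -> set T'), (forall i, measurable (B i)) ->
    P (\bigcap_(i in [set` J]) (X i @^-1` B i)) =
    (\prod_(i in J) P (X i @^-1` B i))%E.

(* Row space spanned by the vectors x_i, i \in A, as a square matrix. *)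
Definition span_of (R : realType) (N : nat) (I : finType) (x : I -> 'rV[R]_N)
    (A : {set I}) : 'M[R]_N := (\sum_(i in A) <<x i>>)%MS.

(* Matrix of the orthogonal projection onto the row space of V, acting on row
   vectors by v |-> v *m P; kermx V^T spans the orthogonal complement of V. *)
Definition orth_proj (R : realType) (m N : nat) (V : 'M[R]_(m, N)) : 'M[R]_N :=
  proj_mx <<V>>%MS (kermx V^T).

(* Main.v *)
From HB Require Import structures.
Require Import Defs.
From mathcomp Require Import all_boot all_order all_algebra.
From mathcomp Require Import all_classical all_reals all_analysis.
From mathcomp Require Import measurable_realfun ring lra.
Import Order.TTheory GRing.Theory Num.Theory.
Import numFieldNormedType.Exports.
Local Open Scope classical_set_scope.
Local Open Scope ring_scope.

(* Unless R2 >= 1, in which case there is nothing to prove, N delta^2 >= 4 s, so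
   that the lower bound is negative; and if eps >= 2 the upper bound exceeds
   N / s >= N tr[P_l P_k] / s^2.  In the remaining case it is enough that
   tr[P_l P_k] <= s eps^2 / 4 outside an event of probability
   2 s 4^s exp(- N eps^2 / 32) <= R2.
   Expanding P_k by Gram-Schmidt along the x_i, i in J_k, the trace is a sum of s
   terms |v P_l|^2 / |v|^2 with v = x_i (1 - Q), where Q, like P_l, depends only
   on vectors independent of x_i.  With tau = eps^2 / 8, each term is at most
   tau / (1 - tau) <= eps^2 / 4 as soon as |x_i Q|^2 <= tau and
   |x_i (1 - Q) P_l|^2 <= tau.  For fixed Q and P_l these are bounds on |x A|^2
   for a contraction A of rank at most s, and
   E exp(N |x A|^2 / 4) <= 4^s follows from E exp<x, u> <= exp(|u|^2 / (2 N)) by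
   summing over u in a lattice of dimension s. *)

(** * Orthogonal projections and Gram-Schmidt *)

Definition dot {R : realType} {N : nat} (u v : 'rV[R]_N) : R := (u *m v^T) 0 0.

Section dot_theory.
Context {R : realType} {N : nat}.
Implicit Types (u v w : 'rV[R]_N).

Lemma dotE u v : dot u v = \sum_j u 0 j * v 0 j.
Proof. by rewrite /dot mxE; apply: eq_bigr => j _; rewrite mxE. Qed.

Lemma dotC u v : dot u v = dot v u.
Proof. by rewrite !dotE; apply: eq_bigr => j _; rewrite mulrC. Qed.

Lemma dotDl u v w : dot (u + v) w = dot u w + dot v w.
Proof. by rewrite /dot mulmxDl mxE. Qed.

Lemma dotNl u v : dot (- u) v = - dot u v.
Proof. by rewrite /dot mulNmx mxE. Qed.

Lemma dotZl a u v : dot (a *: u) v = a * dot u v.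
Proof. by rewrite /dot -scalemxAl mxE. Qed.

Lemma dotDr u v w : dot w (u + v) = dot w u + dot w v.
Proof. by rewrite ![dot w _]dotC dotDl. Qed.

Lemma dotNr u v : dot u (- v) = - dot u v.
Proof. by rewrite ![dot u _]dotC dotNl. Qed.

Lemma dotZr a u v : dot u (a *: v) = a * dot u v.
Proof. by rewrite ![dot u _]dotC dotZl. Qed.

Lemma dot_ge0 u : 0 <= dot u u.
Proof. by rewrite dotE sumr_ge0// => j _; rewrite -expr2 sqr_ge0. Qed.

Lemma dot_eq0 u : (dot u u == 0) = (u == 0).
Proof.
apply/eqP/eqP => [|->]; last by rewrite /dot mul0mx mxE.
rewrite dotE => /eqP; rewrite psumr_eq0; last first.
  by move=> j _; rewrite -expr2 sqr_ge0.
move=> /allP u0; apply/rowP => j; rewrite mxE; apply/eqP.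
by move: (u0 j); rewrite mem_index_enum -expr2 sqrf_eq0 => /(_ isT).
Qed.

Lemma mulmx_rowtr u v : u *m v^T = (dot u v)%:M.
Proof. by rewrite [LHS]mx11_scalar. Qed.

Lemma dot_mulmxr m (u : 'rV[R]_m) v (A : 'M[R]_(m, N)) :
  dot (u *m A) v = dot u (v *m A^T).
Proof. by rewrite /dot trmx_mul trmxK mulmxA. Qed.

Lemma mxtrace_rank1 (A : 'M[R]_N) v : \tr (A *m (v^T *m v)) = dot (v *m A) v.
Proof. by rewrite mulmxA mxtrace_mulC mulmxA /mxtrace big_ord1. Qed.

End dot_theory.

(** With $a = kB^T$, expanding $|k - aB|^2 \ge 0$ gives $2|a|^2 \le |k|^2 + |aB|^2$, and $|aB|^2 \le
    |a|^2$ by hypothesis. *)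
Lemma dot_adjoint_le {R : realType} {N m : nat} (B : 'M[R]_(N, m)) :
  (forall v, dot (v *m B) (v *m B) <= dot v v) ->
  forall k : 'rV[R]_m, dot (k *m B^T) (k *m B^T) <= dot k k.
Proof.
move=> Bc k; set a := k *m B^T.
have := dot_ge0 (k - a *m B).
rewrite dotDl !dotDr !dotNl !dotNr [dot k (a *m B)]dotC [dot (a *m B) k]dot_mulmxr.
rewrite -/a; have := Bc a; lra.
Qed.

(* The Householder reflection exchanging [u] and [v]. *)
Lemma orthogonal_transitive {R : realType} {N : nat} (u v : 'rV[R]_N) :
  dot u u = dot v v ->
  exists Q : 'M[R]_N, Q *m Q^T = 1%:M /\ u *m Q = v.
Proof.
move=> uv; have [d dE] : exists d, d = u - v by exists (u - v).
pose c := 2 / dot d d.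
(* Equality of the norms makes [c * dot u d] equal to 1, so the reflection along [d] sends [u] to
   [u - d = v]. *)
have dd : dot d d = 2 * dot u d.
  rewrite dE dotDl !dotDr !dotNl !dotNr -uv [dot v u]dotC; ring.
have [d0|d0] := eqVneq d 0.
  exists 1%:M; rewrite trmx1 mulmx1; split=> //; rewrite mulmx1.
  by apply/eqP; rewrite -subr_eq0 -dE d0.
have dd0 : dot d d != 0 by rewrite dot_eq0.
exists (1%:M - c *: (d^T *m d)); split.
  rewrite [(_ - _)^T]linearB/= trmx1 [(c *: _)^T]linearZ/= trmx_mul trmxK.
  rewrite mulmxBl mul1mx mulmxBr mulmx1 -scalemxAl -scalemxAr.
  rewrite mulmxA -(mulmxA d^T) mulmx_rowtr mul_mx_scalar -scalemxAl.
  have cc : c * (c * dot d d) = c + c by rewrite /c; field; exact: dd0.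
  by rewrite !scalerA cc scalerDl opprB addrK subrK.
rewrite mulmxBr mulmx1 -scalemxAr mulmxA mulmx_rowtr mul_scalar_mx scalerA.
rewrite (_ : c * _ = 1); first by rewrite scale1r dE subKr.
have ud0 : dot u d != 0 by move: dd0; rewrite dd mulf_eq0 => /norP[].
by rewrite /c dd; field.
Qed.

Definition is_orth_proj {R : realType} {N : nat} (P : 'M[R]_N) :=
  P^T = P /\ P *m P = P.

Section orth_proj_theory.
Context {R : realType} {N : nat}.
Implicit Types (P : 'M[R]_N) (u v w x : 'rV[R]_N).

Lemma is_orth_proj0 : is_orth_proj (0 : 'M[R]_N).
Proof. by split; rewrite ?trmx0 ?mul0mx. Qed.

Lemma is_orth_projC P : is_orth_proj P -> is_orth_proj (1%:M - P).
Proof.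
move=> [Pt PP]; split; first by rewrite linearB/= trmx1 Pt.
by rewrite mulmxBl mul1mx mulmxBr mulmx1 PP subrr subr0.
Qed.

Lemma dot_projl P v : is_orth_proj P -> dot (v *m P) v = dot (v *m P) (v *m P).
Proof. by move=> [Pt PP]; rewrite [RHS]dot_mulmxr Pt -mulmxA PP dotC. Qed.

Lemma dot_projC P v : is_orth_proj P ->
  dot (v *m (1%:M - P)) (v *m (1%:M - P)) = dot v v - dot (v *m P) (v *m P).
Proof.
move=> hP; rewrite -dot_projl; last exact: is_orth_projC.
by rewrite mulmxBr mulmx1 dotDl dotNl dot_projl.
Qed.

Lemma dot_proj_le P v : is_orth_proj P -> dot (v *m P) (v *m P) <= dot v v.
Proof. by move=> hP; rewrite -subr_ge0 -dot_projC// dot_ge0. Qed.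

(** Split $1 = P + (1 - P)$: the rows of $P$ lie in the row space of [V] and those of $1 - P$ in its
    orthogonal complement, so [proj_mx] fixes the former and kills the latter. *)
Lemma orth_proj_unique m (V : 'M[R]_(m, N)) P :
  is_orth_proj P -> (P :=: V)%MS -> orth_proj V = P.
Proof.
move=> [Pt PP] PV; rewrite /orth_proj.
have VP : V *m P = V.
  have /submxP[D ->] : (V <= P)%MS by rewrite PV.
  by rewrite -mulmxA PP.
(* A vector [w] of both spaces satisfies [w *m P = w], being in the range of [P], and [w *m P = 0],
   being orthogonal to that range. *)
have PcapK : (<<V>> :&: kermx V^T = 0)%MS.
  apply/eqP; rewrite -submx0; apply/row_subP => i.
  set w := row i _; have : (w <= <<V>> :&: kermx V^T)%MS by exact: row_sub.
  rewrite sub_capmx genmxE => /andP[wV /sub_kermxP wK].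
  have /submxP[D wD] : (w <= P)%MS by rewrite PV.
  have /submxP[C PC] : (P <= V)%MS by rewrite PV.
  have : w *m P = 0 by rewrite -Pt PC trmx_mul mulmxA wK mul0mx.
  by rewrite wD -mulmxA PP => ->; exact: sub0mx.
rewrite -[LHS]mul1mx -(subrK P 1%:M) mulmxDl proj_mx_0 //; last first.
  apply/sub_kermxP; rewrite mulmxBl mul1mx -Pt -trmx_mul VP.
  by rewrite subrr.
by rewrite add0r proj_mx_id // genmxE -PV.
Qed.

End orth_proj_theory.

(* Gram-Schmidt from the last vector to the first; a vector in the span of the
   following ones contributes 0 because [0^-1 = 0]. *)
Fixpoint gs_proj {R : realType} {N : nat} (xs : seq 'rV[R]_N) : 'M[R]_N :=
  if xs is x :: xs' then
    let v := x *m (1%:M - gs_proj xs') in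
    gs_proj xs' + (dot v v)^-1 *: (v^T *m v)
  else 0.

Section gs_proj_theory.
Context {R : realType} {N : nat}.
Implicit Types (A P : 'M[R]_N) (v x : 'rV[R]_N) (xs : seq 'rV[R]_N).

(** The new direction [v] satisfies [v *m P = 0], so the cross terms of the square vanish and the
    rank-one term is idempotent by itself. *)
Lemma is_orth_proj_gs xs : is_orth_proj (gs_proj xs).
Proof.
elim: xs => [|x xs [Pt PP]] /=; first exact: is_orth_proj0.
set P := gs_proj xs in Pt PP *; set v := x *m _; set c := _^-1.
have vP : v *m P = 0 by rewrite /v -mulmxA mulmxBl mul1mx PP subrr mulmx0.
have Pv : P *m v^T = 0 by rewrite -Pt -trmx_mul vP trmx0.
split; first by rewrite linearD/= Pt linearZ/= trmx_mul trmxK.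
rewrite mulmxDl !mulmxDr PP -!scalemxAr -!scalemxAl mulmxA Pv mul0mx scaler0 addr0.
rewrite -(mulmxA _ v P) vP mulmx0 scaler0 add0r; congr (_ + _).
rewrite mulmxA -(mulmxA _ v) mulmx_rowtr mul_mx_scalar -scalemxAl.
rewrite !scalerA /c; have [->|v0] := eqVneq (dot v v) 0; first by rewrite invr0 !mul0r.
by rewrite -mulrA mulVf ?mulr1.
Qed.

Lemma gs_proj_span xs : (gs_proj xs :=: \sum_(x <- xs) <<x>>)%MS.
Proof.
elim: xs => [|x xs IH] /=; first by rewrite big_nil.
rewrite big_cons; set P := gs_proj xs in IH *; set v := x *m _; set c := _^-1.
have [Pt PP] : is_orth_proj P by exact: is_orth_proj_gs.
have vP : v *m P = 0 by rewrite /v -mulmxA mulmxBl mul1mx PP subrr mulmx0.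
have Pv : P *m v^T = 0 by rewrite -Pt -trmx_mul vP trmx0.
have xE : x = v + x *m P by rewrite /v mulmxBr mulmx1 subrK.
set V := (\sum_(_ <- _) _)%MS in IH *.
apply/eqmxP/andP; split.
  have PV : (P <= <<x>> + V)%MS by rewrite IH addsmxSr.
  apply: addmx_sub => //; apply: scalemx_sub; apply: mulmx_sub.
  rewrite /v mulmxBr mulmx1 addmx_sub//.
    by apply: (submx_trans _ (addsmxSl _ _)); rewrite genmxE.
  by rewrite eqmx_opp; apply: mulmx_sub.
(* Multiplying the new projection on the left by [P] returns [P], and by [v] returns [v]; both thus
   lie in its row space, and so does [x]. *)
have PP' : (P <= (P + c *: (v^T *m v))%R)%MS.
  apply/submxP; exists P; rewrite mulmxDr PP -scalemxAr mulmxA Pv mul0mx.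
  by rewrite scaler0 addr0.
rewrite addsmx_sub -IH PP' andbT genmxE {1}xE addmx_sub//; last first.
  exact: mulmx_sub.
have [->|v0] := eqVneq v 0; first exact: sub0mx.
apply/submxP; exists v; rewrite mulmxDr vP add0r -scalemxAr mulmxA mulmx_rowtr.
by rewrite mul_scalar_mx scalerA mulVf ?scale1r// dot_eq0.
Qed.

Lemma orth_proj_span_of (I : finType) (x : I -> 'rV[R]_N) (J : {set I}) :
  orth_proj (span_of x J) = gs_proj [seq x i | i <- enum J].
Proof.
apply: orth_proj_unique; first exact: is_orth_proj_gs.
have := gs_proj_span [seq x i | i <- enum J].
by rewrite big_map big_enum.
Qed.

(** The rows of [U] are the normalized Gram-Schmidt vectors. Their number is what bounds the rank in
    [rank_contraction]. *)
Lemma gs_proj_factor xs :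
  exists U : 'M[R]_(size xs, N), gs_proj xs = U^T *m U.
Proof.
elim: xs => [|x xs [U UE]] /=; first by exists 0; rewrite trmx0 mulmx0.
set v := x *m _; pose u := Num.sqrt (dot v v)^-1 *: v.
exists (col_mx u U : 'M[R]_(1 + size xs, N)).
transitivity (u^T *m u + U^T *m U); last by rewrite -mul_row_col -tr_col_mx.
rewrite -UE addrC /u [(_ *: v)^T]linearZ/= -scalemxAr -scalemxAl.
by rewrite scalerA -expr2 sqr_sqrtr// invr_ge0 dot_ge0.
Qed.

Lemma mxtrace_gs_cons A x xs : let v := x *m (1%:M - gs_proj xs) in
  \tr (A *m gs_proj (x :: xs)) =
  \tr (A *m gs_proj xs) + dot (v *m A) v / dot v v.
Proof.
by move=> v; rewrite /= -/v [A *m _]mulmxDr mxtraceD -scalemxAr mxtraceZ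
  mxtrace_rank1 mulrC.
Qed.

(** Each Gram-Schmidt direction [v] contributes $|vP|^2/|v|^2$, which lies in $[0,1]$. *)
Lemma mxtrace_proj_gs P xs : is_orth_proj P ->
  0 <= \tr (P *m gs_proj xs) <= (size xs)%:R.
Proof.
move=> hP; elim: xs => [|x xs /andP[IH0 IH1]].
  by rewrite mulmx0 mxtrace0 lexx.
rewrite mxtrace_gs_cons; set v := x *m _.
have dP : 0 <= dot (v *m P) v / dot v v <= 1.
  rewrite dot_projl// divr_ge0 ?dot_ge0//=.
  have [->|v0] := eqVneq (dot v v) 0; first by rewrite invr0 mulr0 ler01.
  by rewrite ler_pdivrMr ?mul1r ?dot_proj_le// lt0r v0 dot_ge0.
by rewrite -[(size (x :: xs))%:R]natr1; lra.
Qed.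

(** The first bound gives $|v|^2 \ge (1-\tau)|x|^2$ by Pythagoras, the second $|vP|^2 \le
    \tau|x|^2$; the new term is their ratio, or 0 when $v = 0$. *)
Lemma mxtrace_gs_cons_le P x xs (tau : R) : is_orth_proj P -> 0 <= tau < 1 ->
  let Q := gs_proj xs in
  dot (x *m Q) (x *m Q) <= tau * dot x x ->
  dot (x *m ((1%:M - Q) *m P)) (x *m ((1%:M - Q) *m P)) <= tau * dot x x ->
  \tr (P *m gs_proj (x :: xs)) <= \tr (P *m Q) + tau / (1 - tau).
Proof.
move=> hP /andP[tau0 tau1] Q h1 h2; rewrite mxtrace_gs_cons lerD2l -/Q.
set v := x *m _; rewrite mulmxA -/v in h2.
have hQ : is_orth_proj Q by exact: is_orth_proj_gs.
have vE : dot v v = dot x x - dot (x *m Q) (x *m Q) by exact: dot_projC.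
rewrite dot_projl//; have [->|v0] := eqVneq (dot v v) 0.
  by rewrite invr0 mulr0 divr_ge0// subr_ge0 ltW.
have vgt0 : 0 < dot v v by rewrite lt0r v0 dot_ge0.
have t1 : 0 < 1 - tau by rewrite subr_gt0.
rewrite ler_pdivrMr// mulrAC ler_pdivlMr//.
set a := dot (v *m P) _ in h2 *; have a0 : 0 <= a by exact: dot_ge0.
have xv : (1 - tau) * dot x x <= dot v v by lra.
apply: (@le_trans _ _ (tau * dot x x * (1 - tau))); first by rewrite ler_wpM2r// ltW.
by rewrite -mulrA ler_wpM2l// mulrC.
Qed.

(* [A] has at most [m] nonzero singular values, none of them above 1. *)
Definition rank_contraction (m : nat) (A : 'M[R]_N) :=
  (forall v, dot (v *m A) (v *m A) <= dot v v) /\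
  exists B : 'M[R]_(N, m), A *m A^T = B *m B^T.

Lemma rank_contraction_gs xs : rank_contraction (size xs) (gs_proj xs).
Proof.
split=> [v|]; first by apply: dot_proj_le; exact: is_orth_proj_gs.
have [U UE] := gs_proj_factor xs; have [Pt PP] := is_orth_proj_gs xs.
by exists U^T; rewrite Pt PP trmxK.
Qed.

(** Serves for $(1 - Q)P_l$, which need not be a projection. *)
Lemma rank_contraction_proj_gs Q xs : is_orth_proj Q ->
  rank_contraction (size xs) (Q *m gs_proj xs).
Proof.
move=> hQ; have hP := is_orth_proj_gs xs; split=> [v|].
  by rewrite mulmxA; apply: (le_trans (dot_proj_le _ _ hP)); exact: dot_proj_le.
have [U UE] := gs_proj_factor xs; have [Pt PP] := hP.
exists (Q *m U^T); rewrite !trmx_mul Pt trmxK mulmxA -(mulmxA Q _ (gs_proj xs)).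
by rewrite PP UE !mulmxA.
Qed.

End gs_proj_theory.

(** * The moment generating function of the uniform law on the sphere *)

Section cosh_bound.
Context {R : realType}.

(** This is $2(z\cosh z - \sinh z)$, which appears in the derivative of $2\cosh z\,e^{-z^2/2}$. *)
Let psi (z : R) := z * (expR z + expR (- z)) - (expR z - expR (- z)).

Let psi_ge0 (z : R) : 0 <= z -> 0 <= psi z.
Proof.
move=> z0.
have dpsi (y : R) : is_derive y 1 psi (y * (expR y - expR (- y))).
  by apply: is_derive_eq; rewrite /GRing.scale/=; ring.
have [c] := @MVT_segment _ psi _ 0 z z0 (fun y _ => dpsi y)
  (derivable_within_continuous (fun y _ => @ex_derive _ _ _ _ _ _ _ (dpsi y))).
have psi0 : psi 0 = 0 by rewrite /psi oppr0 mul0r subrr subr0.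
rewrite in_itv/= => /andP[c0 _]; rewrite psi0 !subr0 => ->.
rewrite !mulr_ge0// subr_ge0 ler_expR; lra.
Qed.

(** By evenness take $z \ge 0$; there $2\cosh z\,e^{-z^2/2}$ starts at 2 and has derivative
    $-\psi(z)e^{-z^2/2} \le 0$. *)
Lemma expR_cosh_le (z : R) : expR z + expR (- z) <= 2 * expR (z ^+ 2 / 2).
Proof.
wlog z0 : z / 0 <= z => [hw|].
  have [|/ltW z0] := leP 0 z; first exact: hw.
  by have := hw (- z); rewrite opprK sqrrN addrC oppr_ge0; exact.
pose phi (y : R) := (expR y + expR (- y)) * expR (- (y ^+ 2 / 2)).
have dphi (y : R) : is_derive y 1 phi (- (psi y * expR (- (y ^+ 2 / 2)))).
  by apply: is_derive_eq; rewrite /GRing.scale/= /psi; field.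
have [c] := @MVT_segment _ phi _ 0 z z0 (fun y _ => dphi y)
  (derivable_within_continuous (fun y _ => @ex_derive _ _ _ _ _ _ _ (dphi y))).
rewrite in_itv/= => /andP[c0 _] phic.
have : phi z <= 2.
  have -> : 2 = phi 0 by rewrite /phi expr0n/= mul0r !oppr0 expR0 mulr1.
  rewrite -subr_le0 phic subr0 mulNr oppr_le0 !mulr_ge0 ?expR_ge0//.
  exact: psi_ge0.
by rewrite /phi [expR (- (_ / 2))]expRN ler_pdivrMr ?expR_gt0.
Qed.

End cosh_bound.

Section borel_rV_theory.
Context {R : realType} {N : nat}.

Lemma measurable_coord (j : 'I_N) :
  measurable_fun setT (fun v : borel_rV R N => (v : 'rV[R]_N) 0 j).
Proof.
apply: (measurability _ (RGenOpens.measurableE R)).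
move=> _ [_ [a [b ->] <-]]; rewrite setTI.
apply: sub_sigma_algebra; apply: open_comp; last exact: interval_open.
by move=> v _; exact: coord_continuous.
Qed.

Lemma measurable_dot d (T : measurableType d) (f g : T -> 'rV[R]_N) :
  (forall j, measurable_fun setT (fun w => f w 0 j)) ->
  (forall j, measurable_fun setT (fun w => g w 0 j)) ->
  measurable_fun setT (fun w => dot (f w) (g w)).
Proof.
move=> mf mg; under eq_fun do rewrite dotE.
by apply: measurable_sum => j; exact: measurable_funM.
Qed.

Lemma measurable_mulmx d (T : measurableType d) (p q r : nat)
    (f : T -> 'M[R]_(p, q)) (g : T -> 'M[R]_(q, r)) :
  (forall i j, measurable_fun setT (fun w => f w i j)) ->
  (forall i j, measurable_fun setT (fun w => g w i j)) ->
  forall i j, measurable_fun setT (fun w => (f w *m g w) i j).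
Proof.
move=> mf mg i j; under eq_fun do rewrite mxE.
by apply: measurable_sum => k; exact: measurable_funM.
Qed.

(** The matrix may vary with the sample point, so this covers a fixed matrix, events on the
    probability space and events on a product. *)
Lemma measurable_stretched d (T : measurableType d) (tau : R)
    (f : T -> 'rV[R]_N) (A : T -> 'M[R]_N) :
  (forall j, measurable_fun setT (fun w => f w 0 j)) ->
  (forall a b, measurable_fun setT (fun w => A w a b)) ->
  measurable [set w | tau * dot (f w) (f w) < dot (f w *m A w) (f w *m A w)].
Proof.
move=> mf mA; set S := [set w | _].
rewrite (_ : S = (fun w => dot (f w *m A w) (f w *m A w) -
   tau * dot (f w) (f w)) @^-1` `]0, +oo[); last first.
  by apply/seteqP; split => v; rewrite /S/= in_itv/= andbT subr_gt0.
rewrite -[X in measurable X]setTI.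
have mfA j : measurable_fun setT (fun w => (f w *m A w) 0 j).
  by apply: measurable_mulmx => // k l; rewrite (ord1 k).
apply: measurable_funB => //; first exact: measurable_dot.
by apply: measurable_funM => //; exact: measurable_dot.
Qed.

Lemma measurable_dotr (u : 'rV[R]_N) :
  measurable_fun setT (fun v : borel_rV R N => dot (v : 'rV[R]_N) u).
Proof.
by apply: measurable_dot => j; [exact: measurable_coord|exact: measurable_cst].
Qed.

Definition dotr (u : 'rV[R]_N) (v : borel_rV R N) : R := dot (v : 'rV[R]_N) u.

HB.instance Definition _ (u : 'rV[R]_N) :=
  isMeasurableFun.Build _ _ _ _ (dotr u) (measurable_dotr u).

End borel_rV_theory.

Section uniform_mgf.
Context {R : realType} {N : nat} (mu : probability (borel_rV R N) R).
Hypothesis hmu : uniform_on_sphere mu.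
Implicit Types (u v : 'rV[R]_N).

Definition mgf u : \bar R := (\int[mu]_v (expR (dot (v : 'rV[R]_N) u))%:E)%E.

Lemma measurable_expR_dot u : measurable_fun setT
  (fun v : borel_rV R N => (expR (dot (v : 'rV[R]_N) u))%:E).
Proof.
apply/measurable_EFinP; apply: measurableT_comp => //.
exact: measurable_dotr.
Qed.

Lemma unit_sphere_ae : {ae mu, forall v : borel_rV R N,
  dot (v : 'rV[R]_N) (v : 'rV[R]_N) = 1}.
Proof.
have msph : measurable (@unit_sphere R N).
  rewrite (_ : @unit_sphere R N = (fun v : borel_rV R N =>
    dot (v : 'rV[R]_N) (v : 'rV[R]_N)) @^-1` [set 1]); last first.
    apply/seteqP; split => v /=; rewrite /unit_sphere/= dotE;
    by under eq_bigr do rewrite expr2.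
  rewrite -[X in measurable X]setTI.
  by apply: measurable_dot => // j; exact: measurable_coord.
exists (~` @unit_sphere R N); split.
- exact: measurableC.
- by rewrite probability_setC// hmu.1 subee.
- apply: subsetC => v; rewrite /unit_sphere/= => <-.
  by rewrite dotE; apply: eq_bigr => j _; rewrite expr2.
Qed.

(** The integral depends only on the law of $\langle v,u\rangle$. A reflection carrying [u'] to [u]
    turns the event $\langle v,u\rangle \in B$ into $\langle v,u'\rangle \in B$. *)
Lemma mgf_rotation_invariant u u' : dot u u = dot u' u' -> mgf u = mgf u'.
Proof.
move=> Hu.
have mgfE w : mgf w = (\int[distribution mu (dotr w)]_y (expR y)%:E)%E.
  rewrite ge0_integral_distribution//; exact/measurable_EFinP.
rewrite !mgfE; apply: eq_measure_integral => B mB _.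
have [Q [QQ uQ]] := orthogonal_transitive u' u (esym Hu).
have mA : measurable (dotr u @^-1` B : set (borel_rV R N)).
  by rewrite -[X in measurable X]setTI; exact: measurable_dotr.
transitivity (mu [set v : 'rV[R]_N | (dotr u @^-1` B) (v *m Q)]).
  exact/esym/(hmu.2 Q QQ).
congr (mu _); apply/seteqP; split => v /=;
by rewrite /dotr dot_mulmxr -uQ -mulmxA QQ mulmx1.
Qed.

(* By rotation invariance [u] may be replaced by any vector with entries [+-t];
   averaging over the signs factors the exponential over the coordinates, and
   [cosh z <= expR (z ^+ 2 / 2)] leaves only the norm of [v], which is 1. *)
Lemma mgf_le u : (0 < N)%N -> (mgf u <= (expR (dot u u / (2 * N%:R)))%:E)%E.
Proof.
move=> N0; have NR : (N%:R : R) != 0 by rewrite pnatr_eq0 -lt0n.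
(* A vector with all entries $\pm t$ has squared norm $Nt^2 = |u|^2$. *)
pose t := Num.sqrt (dot u u / N%:R).
have tt : t ^+ 2 = dot u u / N%:R by rewrite sqr_sqrtr// divr_ge0// dot_ge0.
pose e (b : bool) : R := if b then t else - t.
pose us (f : {ffun 'I_N -> bool}) : 'rV[R]_N := \row_j e (f j).
have us_dot f : dot (us f) (us f) = dot u u.
  rewrite dotE (eq_bigr (fun=> t ^+ 2)) => [|j _]; last first.
    by rewrite mxE /e; case: ifP; rewrite ?mulrNN expr2.
  by rewrite sumr_const card_ord tt -[_ *+ N]mulr_natr divfK.
have sumE v : \sum_f expR (dot v (us f)) =
    \prod_j (expR (v 0 j * t) + expR (- (v 0 j * t))).
  under [RHS]eq_bigr => j _.
    rewrite (_ : _ + _ = \sum_(b : bool) expR (v 0 j * e b)); last first.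
      by rewrite big_bool/= mulrN.
    over.
  rewrite (bigA_distr_bigA (fun j b => expR (v 0 j * e b))).
  apply: eq_bigr => f _; rewrite dotE expR_sum; apply: eq_bigr => j _.
  by rewrite mxE.
have sum_mgf : (\sum_f mgf (us f) <= (2 ^+ N * expR (dot u u / (2 * N%:R)))%:E)%E.
  rewrite -ge0_integral_sum//; last by move=> f; exact: measurable_expR_dot.
  have -> : ((2 ^+ N * expR (dot u u / (2 * N%:R)))%:E =
    \int[mu]_v (cst (2 ^+ N * expR (dot u u / (2 * N%:R)))%:E) v)%E.
    rewrite integral_cst// -[LHS]mule1; congr (_ * _)%E.
    exact/esym/probability_setT.
  apply: ae_ge0_le_integral => //.
  - by move=> v _; apply: sume_ge0 => f _; rewrite lee_fin expR_ge0.
  - by apply: emeasurable_sum => f; exact: measurable_expR_dot.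
  - by move=> v _; rewrite lee_fin mulr_ge0 ?expR_ge0// exprn_ge0.
  apply: filterS unit_sphere_ae => v vv _; rewrite sumEFin lee_fin sumE.
  apply: (@le_trans _ _ (\prod_(j < N) (2 * expR ((v 0 j * t) ^+ 2 / 2)))).
    apply: ler_prod => j _; rewrite addr_ge0 ?expR_ge0//=.
    exact: expR_cosh_le.
  rewrite big_split/= prodr_const card_ord -expR_sum.
  rewrite ler_wpM2l ?exprn_ge0// ler_expR.
  have -> : \sum_j (v 0 j * t) ^+ 2 / 2 = dot v v * (t ^+ 2 / 2).
    rewrite dotE mulr_suml; apply: eq_bigr => j _.
    by rewrite exprMn -expr2 -mulrA.
  by rewrite vv mul1r tt invfM mulrA mulrAC.
rewrite (eq_bigr (fun=> mgf u)) in sum_mgf; last first.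
  by move=> f _; apply: mgf_rotation_invariant.
have mgf0 : (0 <= mgf u)%E by apply: integral_ge0 => v _; rewrite lee_fin expR_ge0.
move: sum_mgf mgf0; case: (mgf u) => [r| |] //.
  move=> + _; rewrite sumEFin !lee_fin sumr_const card_ffun card_bool card_ord.
  by rewrite -[r *+ _]mulr_natl natrX ler_pM2l// exprn_gt0.
(* An infinite [mgf u] would make the whole sum infinite, against its finite bound. *)
rewrite (bigD1 [ffun=> true])//= => + _; rewrite addye// gt_eqF//.
by apply: (@lt_le_trans _ _ 0%E) => //; exact: sume_ge0.
Qed.

End uniform_mgf.

(** * Tails of contractions of small rank *)

Section half_integers.
Context {R : realType}.

(** The points $\pm 1/2, \pm 3/2, \dots$: since 0 is avoided, sign and integer part determine the
    point without repetition. *)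
Definition half_int {n : nat} (p : bool * 'I_n) : R :=
  (-1) ^+ p.1 * (p.2%:R + 1 / 2).

Lemma half_int_near (n : nat) (y Y : R) : `|y| <= Y -> (Num.truncn Y < n)%N ->
  exists p : bool * 'I_n, (half_int p - y) ^+ 2 <= 1 / 4.
Proof.
move=> yY Yn; have kn : (Num.truncn `|y| < n)%N.
  by apply: leq_ltn_trans Yn; exact: le_truncn.
exists (y < 0, Ordinal kn); rewrite /half_int/= -[X in _ - X]mulr_sign_norm.
rewrite -mulrBr exprMn sqrr_sign mul1r.
have /andP[] := truncn_itv (normr_ge0 y); rewrite -natr1; nra.
Qed.

(** From $i \le i^2$, $1/2 - (i+1/2)^2 \le 1/4 - 2i$; with $e^{1/4} \le 4/3$ and $e^{-2} \le 1/3$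
    each sign contributes at most $(4/3)(3/2) = 2$. *)
Lemma sum_expR_half_int (n : nat) :
  \sum_(p : bool * 'I_n) expR (1 / 2 - half_int p ^+ 2) <= 4.
Proof.
have e4 : expR (1 / 4) <= 4 / 3 :> R.
  have := expR_ge1Dx (- (1 / 4) : R); rewrite expRN => h.
  have e0 := expR_gt0 (1 / 4 : R).
  have : 3 / 4 * expR (1 / 4) <= 1 :> R by rewrite -ler_pdivlMr// [_ / expR _]div1r; lra.
  lra.
have e2 : expR (- 2) <= 1 / 3 :> R.
  have := expR_ge1Dx (2 : R) => h; rewrite expRN div1r lef_pV2 ?posrE ?expR_gt0//.
have term (p : bool * 'I_n) :
    expR (1 / 2 - half_int p ^+ 2) <= 4 / 3 * (1 / 3) ^+ p.2 :> R.
  apply: (@le_trans _ _ (expR (1 / 4) * expR (- 2) ^+ p.2)); last first.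
    apply: ler_pM => //; rewrite ?expR_ge0 ?exprn_ge0 ?expR_ge0//.
    by rewrite lerXn2r ?nnegrE ?expR_ge0//; lra.
  rewrite -expRM_natl -expRD ler_expR /half_int exprMn sqrr_sign mul1r.
  have : (p.2%:R : R) <= p.2%:R ^+ 2.
    by rewrite -natrX ler_nat; case: (val p.2) => // k; rewrite leq_pmulr.
  lra.
have geom (k : nat) : \sum_(i < k) (1 / 3 : R) ^+ i = 3 / 2 * (1 - (1 / 3) ^+ k).
  elim: k => [|k IH]; first by rewrite big_ord0 expr0 subrr mulr0.
  by rewrite big_ord_recr/= IH exprS; field.
apply: (le_trans (ler_sum _ (fun p _ => term p))).
rewrite -(pair_bigA_idem _ (fun (_ : bool) (i : 'I_n) => 4 / 3 * (1 / 3) ^+ i))/=;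
  last by rewrite addr0.
rewrite big_bool/= -mulr_sumr geom.
have : 0 <= (1 / 3 : R) ^+ n by rewrite exprn_ge0//; lra.
lra.
Qed.

End half_integers.

Section contraction_tail.
Context {R : realType} {N : nat} (mu : probability (borel_rV R N) R).
Hypothesis hmu : uniform_on_sphere mu.
Hypothesis N0 : (0 < N)%N.

(* Up to the weights, the sum over half-integer points [k] of
   [expR (sqrt (2 N) <k, v B>)] dominates [expR (N / 4 |v B|^2)], and each
   summand is controlled by [mgf_le]. *)
Lemma contraction_tail (m : nat) (A : 'M[R]_N) (tau : R) : rank_contraction m A ->
  (mu [set v : 'rV[R]_N | (tau * dot v v < dot (v *m A) (v *m A))%R] <=
   (4 ^+ m * expR (- (N%:R * tau / 4)))%:E)%E.
Proof.
move=> [Ac [B AB]].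
have NR : (0 : R) < N%:R by rewrite ltr0n.
have dotAB v : dot (v *m B) (v *m B) = dot (v *m A) (v *m A).
  by rewrite !dot_mulmxr -!mulmxA AB.
have Bc v : dot (v *m B) (v *m B) <= dot v v by rewrite dotAB.
pose t : R := Num.sqrt (2 * N%:R).
have tt : t ^+ 2 = 2 * N%:R by rewrite sqr_sqrtr// mulr_ge0// ltW.
have t0 : 0 <= t by exact: sqrtr_ge0.
(* For $|v| = 1$ the coordinates of $t\,vB/4$ are at most $t/4$ in absolute value, so this many
   points suffice for rounding them. *)
pose n := (Num.truncn (t / 4)).+1.
pose pt (f : {ffun 'I_m -> bool * 'I_n}) : 'rV[R]_m := \row_j half_int (f j).
(* For a coordinate $c$ within $1/2$ of $ty/4$, $2(c - ty/4)^2 \le 1/2$ expands to $t^2y^2/8 \le 1/2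
   - 2c^2 + tcy$, and $t^2/8 = N/4$. *)
pose wt (f : {ffun 'I_m -> bool * 'I_n}) : R := \sum_j (1 / 2 - 2 * half_int (f j) ^+ 2).
pose F (v : 'rV[R]_N) : R :=
  \sum_f expR (wt f) * expR (dot v ((t *: pt f) *m B^T)).
have mF : measurable_fun setT (fun v : borel_rV R N => (F (v : 'rV[R]_N))%:E).
  apply/measurable_EFinP; apply: measurable_sum => f.
  by apply: measurable_funM => //; apply/measurable_EFinP; exact: measurable_expR_dot.
have F0 v : 0 <= F v by apply: sumr_ge0 => f _; rewrite mulr_ge0 ?expR_ge0.
have F_lb v : dot v v = 1 -> expR (N%:R / 4 * dot (v *m B) (v *m B)) <= F v.
  move=> vv; have [y yE] : exists y, y = v *m B by exists (v *m B).
  have y1 j : `|t * y 0 j / 4| <= t / 4.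
    have yj : `|y 0 j| <= 1.
      rewrite -(ler_sqr (normr_ge0 _)) ?nnegrE// expr1n real_normK ?num_real//.
      rewrite -vv; apply: le_trans (Bc v); rewrite -yE dotE (bigD1 j)//= -expr2 lerDl.
      by apply: sumr_ge0 => i _; rewrite -expr2 sqr_ge0.
    rewrite !normrM (ger0_norm t0) (@ger0_norm _ 4^-1)// ler_wpM2r// ler_piMr//.
  have /(_ _)/cid-/all_sig[f fP] : forall j, exists p : bool * 'I_n,
      (half_int p - t * y 0 j / 4) ^+ 2 <= 1 / 4.
    by move=> j; exact: half_int_near (y1 j) (ltnSn _).
  rewrite /F (bigD1 [ffun j => f j])//=.
  apply: (@le_trans _ _ (expR (wt [ffun j => f j]) *
      expR (dot v ((t *: pt [ffun j => f j]) *m B^T)))); last first.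
    by rewrite lerDl sumr_ge0// => g _; rewrite mulr_ge0 ?expR_ge0.
  rewrite -yE -expRD ler_expR [dot v _]dotC dot_mulmxr trmxK -yE !dotE mulr_sumr.
  rewrite /wt -big_split/=; apply: ler_sum => j _.
  rewrite !mxE ffunE; have := fP j; set c := half_int _.
  have -> : N%:R = t ^+ 2 / 2 by rewrite tt; field.
  lra.
have F_ub : (\int[mu]_v (F v)%:E <= (4 ^+ m)%:E)%E.
  under eq_integral do rewrite /F -sumEFin.
  rewrite ge0_integral_sum//; last first.
    move=> f; under eq_fun do rewrite EFinM.
    by apply: emeasurable_funM => //; exact: measurable_expR_dot.
  apply: (@le_trans _ _ (\sum_(f : {ffun 'I_m -> bool * 'I_n})
      (\prod_j expR (1 / 2 - half_int (f j) ^+ 2))%:E)%E).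
    apply: lee_sum => f _; under eq_integral do rewrite EFinM.
    rewrite ge0_integralZl//; last exact: measurable_expR_dot.
    apply: (@le_trans _ _ ((expR (wt f))%:E * (expR (dot (pt f) (pt f)))%:E)%E).
      apply: lee_wpmul2l; first by rewrite lee_fin expR_ge0.
      apply: (le_trans (mgf_le _ hmu _ N0)); rewrite lee_fin ler_expR.
      (* Since $t^2 = 2N$, the exponent from [mgf_le] is the squared norm of [pt f *m B^T], at most
         that of [pt f]; added to [wt f] it leaves $1/2 - c^2$ per coordinate. *)
      rewrite -scalemxAl dotZl dotZr mulrA -expr2 tt mulrAC divff ?mul1r; last first.
        by rewrite mulf_neq0// ?gt_eqF.
      exact: dot_adjoint_le.
    rewrite -EFinM lee_fin -expRD -expR_sum ler_expR dotE /wt -big_split/=.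
    by apply: ler_sum => j _; rewrite mxE; lra.
  rewrite sumEFin lee_fin.
  rewrite -(bigA_distr_bigA (fun (j : 'I_m) (p : bool * 'I_n) =>
    expR (1 / 2 - half_int p ^+ 2))).
  rewrite prodr_const card_ord lerXn2r ?nnegrE//; last exact: sum_expR_half_int.
  by apply: sumr_ge0 => p _; exact: expR_ge0.
set S := [set v | _].
have mS : measurable (S : set (borel_rV R N)).
  by apply: measurable_stretched => // j; exact: measurable_coord.
(* Chernoff's argument: almost everywhere on [S], [F] is at least $e^{N\tau/4}$. *)
have key : ((expR (N%:R * tau / 4))%:E * mu S <= (4 ^+ m)%:E)%E.
  apply: (le_trans _ F_ub); rewrite -integral_cst//.
  apply: (@le_trans _ _ (\int[mu]_(v in S) (F v)%:E)%E); last first.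
    by apply: ge0_subset_integral => // v _; rewrite lee_fin F0.
  apply: ae_ge0_le_integral => //.
  - by move=> v _; rewrite lee_fin expR_ge0.
  - by move=> v _; rewrite lee_fin F0.
  - exact: measurable_funTS.
  apply: filterS (unit_sphere_ae _ hmu) => v vv Sv; rewrite lee_fin.
  apply: (le_trans _ (F_lb v vv)); rewrite ler_expR dotAB.
  move: Sv; rewrite /S/= vv mulr1 => /ltW Sv.
  by rewrite mulrAC ler_wpM2l// divr_ge0// ltW.
by rewrite mulrC expRN EFinM lee_pdivlMl ?expR_gt0.
Qed.
End contraction_tail.

(** * Independence *)

(** Independence makes the joint law a product measure, so the probability is the integral of the
    measures of the sections. *)
Lemma indep_section_le (R : realType) (d d1 d2 : measure_display)
    (T : measurableType d) (T1 : measurableType d1) (T2 : measurableType d2)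
    (P : probability T R) (X : {RV P >-> T1}) (Y : {RV P >-> T2}) (p : \bar R)
    (E : set (T1 * T2)) :
  (forall A B, measurable A -> measurable B ->
    P (X @^-1` A `&` Y @^-1` B) = (P (X @^-1` A) * P (Y @^-1` B))%E) ->
  measurable E ->
  (forall a, (distribution P Y (xsection E a) <= p)%E) ->
  (P [set w | E (X w, Y w)] <= p)%E.
Proof.
move=> indep mE Ep.
have mXY : measurable_fun setT (fun w => (X w, Y w)).
  by apply: measurable_fun_pair; exact: measurable_funPT.
pose mixin := isMeasurableFun.Build _ _ _ _ _ mXY.
pose XY : {RV P >-> (T1 * T2)%type} := HB.pack (fun w => (X w, Y w)) mixin.
have -> : P [set w | E (X w, Y w)] = (distribution P X \x distribution P Y)%E E.
  by rewrite (@product_measure_unique _ _ _ _ _ (distribution P X)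
    (distribution P Y) (distribution P XY)).
rewrite /product_measure1.
apply: (@le_trans _ _ (\int[distribution P X]_a (cst p a))%E).
  by apply: ge0_le_integral => // [|a _]; [exact: measurable_fun_xsection|exact: Ep].
rewrite integral_cst// [X in (_ * X)%E](_ : _ = 1%E) ?mule1//.
exact: probability_setT.
Qed.

Section others.
Context {R : realType} {N : nat} {d : measure_display} {T : measurableType d}
  {P : probability T R} {I : finType} (x : I -> {RV P >-> borel_rV R N}).

Definition cylinders (j : I) : set (set T) :=
  [set A | exists B : I -> set (borel_rV R N), (forall i, measurable (B i)) /\
    A = \bigcap_(i in [set` (~: [set j])%SET]) (x i @^-1` B i)].

(* [T] with the sigma-algebra generated by the [x i], [i != j]. *)
Definition others (j : I) := g_sigma_algebraType (cylinders j).

Lemma measurable_others (i j : I) : i != j ->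
  measurable_fun setT (x i : others j -> borel_rV R N).
Proof.
move=> ij _ A mA; rewrite setTI; apply: sub_sigma_algebra.
exists (fun k => if k == i then A else setT); split.
  by move=> k; case: ifP.
apply/seteqP; split => [w Aw k _|w /(_ i)] /=; first by case: ifP => // /eqP ->.
by rewrite eqxx; apply; rewrite /= !inE ij.
Qed.

(** The identity as a random element of the coarser space: it stands for all the [x i], [i != j], at
    once. *)
Definition to_others (j : I) (w : T) : others j := w.

Lemma measurable_to_others (j : I) : measurable_fun setT (to_others j).
Proof.
apply: (@measurability _ _ T (others j) _ _ (cylinders j) erefl).
move=> _ [_ [B [mB ->]] <-]; rewrite setTI.
apply: fin_bigcap_measurable => // i _; rewrite -[X in measurable X]setTI.
exact: (measurable_funPT (x i)).
Qed.

HB.instance Definition _ (j : I) :=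
  isMeasurableFun.Build _ _ _ _ (to_others j) (measurable_to_others j).

Hypothesis hx : mutually_independent x.

(** For fixed [B], both sides are finite measures in [A] that agree on the cylinders, a generating
    family stable under intersection. *)
Lemma indep_others (j : I) (A : set (others j)) (B : set (borel_rV R N)) :
  measurable A -> measurable B ->
  P (to_others j @^-1` A `&` x j @^-1` B) =
  (P (to_others j @^-1` A) * P (x j @^-1` B))%E.
Proof.
move=> mA mB; pose C := x j @^-1` B.
have mC : measurable C.
  by rewrite -[X in measurable X]setTI; exact: (measurable_funPT (x j)).
have PC0 : 0 <= fine (P C) by rewrite fine_ge0.
have cyl_meas : cylinders j `<=` measurable.
  move=> _ [D [mD ->]]; apply: fin_bigcap_measurable => // i _.
  by rewrite -[X in measurable X]setTI; exact: (measurable_funPT (x i)).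
have PC : (fine (P C))%:E = P C by rewrite fineK ?fin_num_measure.
suff mP : mrestr P mC A = mscale (NngNum PC0) P A.
  by rewrite muleC; transitivity (mrestr P mC A) => //; rewrite mP /mscale/= PC.
apply: (@g_sigma_algebra_measure_unique _ _ _ (cylinders j) cyl_meas (fun=> setT)) => //.
- move=> _; exists (fun=> setT); split => //.
  by apply/seteqP; split.
- by rewrite bigcup_const//; exists 0%N.
- move=> _ _ [B1 [mB1 ->]] [B2 [mB2 ->]].
  exists (fun i => B1 i `&` B2 i); split; first by move=> i; exact: measurableI.
  by rewrite bigcapI.
- move=> _ [D [mD ->]].
  (* With [B] put at index [j], independence applies to the same family twice: over all indices and
     over those other than [j]. *)
  pose D' i := if i == j then B else D i.
  have mD' i : measurable (D' i) by rewrite /D'; case: ifP.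
  have DE : \bigcap_(i in [set` (~: [set j])%SET]) (x i @^-1` D i) =
            \bigcap_(i in [set` (~: [set j])%SET]) (x i @^-1` D' i).
    by apply: eq_bigcapr => i /=; rewrite !inE /D' => /negbTE ->.
  rewrite /= /mrestr.
  have -> : (\bigcap_(i in [set` (~: [set j])%SET]) (x i @^-1` D i)) `&` C =
            \bigcap_(i in [set` [set: I]%SET]) (x i @^-1` D' i).
    rewrite DE; apply/seteqP; split => [w [h1 h2] i _|w h].
      have [->|ij] := eqVneq i j; first by rewrite /D' /preimage/= eqxx.
      by apply: h1; rewrite /= !inE.
    split; first by move=> i _; apply: h; rewrite /= inE.
    by have := h j; rewrite /D' /preimage/= eqxx; apply; rewrite /= inE.
  rewrite /mscale/= PC hx// DE hx// (bigD1 j) ?inE//= {1}/D' eqxx; congr (_ * _)%E.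
  by apply: eq_bigl => i; rewrite !inE.
- by move=> _; rewrite /= /mrestr setTI (le_lt_trans (probability_le1 _ _)) ?ltry.
Qed.

End others.

(** * The trace of a product of two projections *)

(** The sigma-algebra is arbitrary: on [others x i] this expresses that the projection depends only
    on the vectors other than [x i]. *)
Lemma measurable_gs_proj (R : realType) (N : nat) (d : measure_display)
    (T : measurableType d) (I : eqType) (f : I -> T -> 'rV[R]_N) (e : seq I) :
  (forall i, i \in e -> forall j, measurable_fun setT (fun w => f i w 0 j)) ->
  forall a b, measurable_fun setT (fun w => gs_proj [seq f i w | i <- e] a b).
Proof.
elim: e => [|i e IH] mf a b /=; first exact: measurable_cst.
have {}IH := IH (fun k ke => mf k (mem_behead (s := i :: e) ke)).
have {}mf := mf i (mem_head _ _).
have mv j : measurable_fun setT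
    (fun w => (f i w *m (1%:M - gs_proj [seq f k w | k <- e])) 0 j).
  apply: measurable_mulmx => [k l|k l]; first by rewrite (ord1 k).
  under eq_fun do rewrite !mxE.
  by apply: measurable_funB => //; exact: measurable_cst.
(* On nonnegative reals the inverse, with value 0 at 0, is the power of exponent -1, which is
   measurable. *)
under eq_fun do rewrite mxE [X in _ + X]mxE -(powR_inv1 (dot_ge0 _)) mxE big_ord1 mxE.
apply: measurable_funD; first exact: IH.
apply: measurable_funM; last by apply: measurable_funM.
apply: (measurableT_comp (measurable_powR (-1))).
exact: measurable_dot.
Qed.

Section projection_trace_tail.
Context {R : realType} {N : nat} {d : measure_display} {T : measurableType d}
  {P : probability T R} {I : finType} (x : I -> {RV P >-> borel_rV R N}).
Hypothesis N0 : (0 < N)%N.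
Hypothesis hx : mutually_independent x.
Hypothesis hu : forall i, uniform_on_sphere (distribution P (x i)).
Variables (tau : R) (m : nat).
Let q : R := 4 ^+ m * expR (- (N%:R * tau / 4)).

(** Freezing the other vectors fixes [A], and each section is then an event of [contraction_tail];
    $4^k \le 4^m$ makes the bound uniform. *)
Lemma contraction_event_le (i : I) (k : nat) (A : T -> 'M[R]_N) :
  (k <= m)%N ->
  (forall a b, measurable_fun setT (fun w : others x i => A w a b)) ->
  (forall w, rank_contraction k (A w)) ->
  (P [set w | (tau * dot (x i w : 'rV[R]_N) (x i w : 'rV[R]_N) <
     dot ((x i w : 'rV[R]_N) *m A w) ((x i w : 'rV[R]_N) *m A w))%R] <= q%:E)%E.
Proof.
move=> km mA cA.
pose E := [set p : others x i * borel_rV R N |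
  tau * dot (p.2 : 'rV[R]_N) (p.2 : 'rV[R]_N) <
  dot ((p.2 : 'rV[R]_N) *m A p.1) ((p.2 : 'rV[R]_N) *m A p.1)].
have mE : measurable E.
  apply: measurable_stretched => [j|a b].
    by apply: (measurableT_comp (measurable_coord j)); exact: measurable_snd.
  by apply: (measurableT_comp (mA a b)); exact: measurable_fst.
have := @indep_section_le _ _ _ _ _ (others x i) (borel_rV R N) P
  (to_others x i) (x i) q%:E E
  (indep_others _ hx i) mE; apply.
move=> a; have -> : xsection E a = [set v : 'rV[R]_N |
    tau * dot v v < dot (v *m A a) (v *m A a)].
  by apply/seteqP; split => v; rewrite /xsection/= inE.
apply: (le_trans (contraction_tail _ (hu i) N0 k _ tau (cA a))).
by rewrite lee_fin ler_wpM2r ?expR_ge0// ler_weXn2l// ler1n.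
Qed.

Let gsx (e : seq I) (w : T) := gs_proj [seq (x i w : 'rV[R]_N) | i <- e].

Lemma measurable_gs_proj_rv (e : seq I) a b :
  measurable_fun setT (fun w : T => gsx e w a b).
Proof.
apply: measurable_gs_proj => i _ j.
by apply: (measurableT_comp (measurable_coord j)); exact: measurable_funPT.
Qed.

Lemma measurable_mxtrace_gs_proj (f e : seq I) :
  measurable_fun setT (fun w => \tr (gsx f w *m gsx e w)).
Proof.
apply: measurable_sum => j.
by apply: measurable_mulmx; exact: measurable_gs_proj_rv.
Qed.

(** Induction on [e]: each new vector costs two events of probability at most [q], one per
    hypothesis of [mxtrace_gs_cons_le]. Both matrices avoid the index [i], by [uniq] and by
    disjointness from [f]. *)
Lemma mxtrace_proj_tail (f e : seq I) : 0 <= tau < 1 -> uniq e ->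
  (forall i, i \in e -> i \notin f) -> (size f <= m)%N -> (size e <= m)%N ->
  (P [set w | ((size e)%:R * (tau / (1 - tau)) < \tr (gsx f w *m gsx e w))%R] <=
   ((size e)%:R * (2 * q))%:E)%E.
Proof.
move=> tau01; elim: e => [_ _ _ _|i e IH /=/andP[ie ue] ef fm em].
  rewrite [X in P X](_ : _ = set0); first by rewrite measure0 /= mul0r.
  by apply/seteqP; split => w //=; rewrite mulmx0 mxtrace0 mul0r ltxx.
have {}IH := IH ue (fun k ke => ef k (mem_behead (s := i :: e) ke)) fm (ltnW em).
have mle (g : seq I) : i \notin g -> forall a b,
    measurable_fun setT (fun w : others x i => gsx g w a b).
  move=> ig; apply: measurable_gs_proj => k kg j.
  apply: (measurableT_comp (measurable_coord j)); apply: measurable_others.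
  by apply: contraNneq ig => <-.
have ifn : i \notin f by apply: ef; exact: mem_head.
pose A2 w := (1%:M - gsx e w) *m gsx f w.
have mA2 a b : measurable_fun setT (fun w : others x i => A2 w a b).
  apply: measurable_mulmx => k l; last exact: mle.
  under eq_fun do rewrite !mxE.
  by apply: measurable_funB; [exact: measurable_cst|exact: mle].
have c1 w : rank_contraction (size e) (gsx e w).
  by have := rank_contraction_gs [seq (x i w : 'rV[R]_N) | i <- e]; rewrite size_map.
have c2 w : rank_contraction (size f) (A2 w).
  have := rank_contraction_proj_gs (1%:M - gsx e w) [seq (x i w : 'rV[R]_N) | i <- f].
  by rewrite size_map; apply; apply: is_orth_projC; exact: is_orth_proj_gs.
have h1 := contraction_event_le i _ _ (ltnW em) (mle _ ie) c1.
have h2 := contraction_event_le i _ _ fm mA2 c2.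
set E0 := [set w | _] in IH; set E1 := [set w | _] in h1; set E2 := [set w | _] in h2.
set E := [set w | _].
have mx j : measurable_fun setT (fun w => (x i w : 'rV[R]_N) 0 j).
  by apply: (measurableT_comp (measurable_coord j)); exact: measurable_funPT.
have mE0 (c : R) g h : measurable [set w | c < \tr (gsx g w *m gsx h w)].
  rewrite (_ : mkset _ = (fun w => \tr (gsx g w *m gsx h w)) @^-1` `]c, +oo[).
    rewrite -[X in measurable X]setTI.
    by apply: measurable_mxtrace_gs_proj => //.
  by apply/seteqP; split => w; rewrite /= in_itv/= andbT.
have mE0' : measurable E0 by exact: mE0.
have mE1 : measurable E1.
  by apply: measurable_stretched => // a b; exact: measurable_gs_proj_rv.
have mE2 : measurable E2.
  apply: measurable_stretched => // a b.
  apply: measurable_mulmx => k l; last exact: measurable_gs_proj_rv.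
  under eq_fun do rewrite !mxE.
  by apply: measurable_funB; [exact: measurable_cst|exact: measurable_gs_proj_rv].
have EU : E `<=` E0 `|` (E1 `|` E2).
  move=> w; rewrite /E/= => Ew.
  apply: contrapT => /not_orP[/negP + /not_orP[/negP + /negP +]].
  rewrite -!leNgt => w0 w1 w2.
  have := @mxtrace_gs_cons_le _ _ (gsx f w) (x i w) [seq (x i w : 'rV[R]_N) | i <- e]
    tau (is_orth_proj_gs _) tau01 w1 w2.
  move: Ew; rewrite -natr1 mulrDl mul1r => Ew.
  by move/(lt_le_trans Ew); rewrite ltNge lerD2r w0.
apply: (@le_trans _ _ (P (E0 `|` (E1 `|` E2)))).
  by apply: le_measure => //; rewrite inE; [exact: mE0|do !apply: measurableU].
apply: (le_trans (measureU2 _ _ _)) => //; first exact: measurableU.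
apply: (@le_trans _ _ (((size e)%:R * (2 * q))%:E + (q%:E + q%:E))%E).
  apply: leeD => //; apply: (le_trans (measureU2 _ _ _)) => //; exact: leeD.
by rewrite -!EFinD lee_fin -[(size e).+1%:R]natr1; lra.
Qed.

End projection_trace_tail.

(** * Reduction to the upper tail, and comparison of the constants with [R2] *)

Theorem lemma4p4 (R : realType) (d : measure_display) (T : measurableType d)
  (P : probability T R) (K s N M : nat) (delta eps : R)
  (hK : (0 < K)%N) (hs : (0 < s)%N) (hN : (0 < N)%N)
  (hM : M = (K * s)%N) (hMN : (N <= M)%N) (hNs : (s <= N)%N)
  (hdelta0 : 0 < delta) (hdelta1 : delta < 1)
  (heps : eps = (1 + delta) ^+ 3 - 1)
  (x : 'I_M -> {RV P >-> borel_rV R N})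
  (hindep : mutually_independent x)
  (hunif : forall i, uniform_on_sphere (distribution P (x i)))
  (J : 'I_K -> {set 'I_M})
  (hJdisj : forall k l : 'I_K, k != l -> J k :&: J l = finset.set0)
  (hJcover : forall i : 'I_M, exists k : 'I_K, i \in J k)
  (hJcard : forall k, #|J k| = s)
  (k l : 'I_K) (hkl : k != l) :
  let proj (j : 'I_K) (w : T) : 'M[R]_N :=
    orth_proj (span_of (fun i => x i w) (J j)) in
  let R1 : R :=
    2 * s%:R * expR ((1 + delta) * s%:R / 2
      - s%:R * (s%:R - 1) * (delta ^+ 2 / 2 - delta ^+ 3 / 3) / 2) in
  let R2 : R :=
    2 * (M%:R + K%:R * (1 + 4 / delta) ^+ s)
      * expR (- (N%:R * delta ^+ 2 / 4) + N%:R * delta ^+ 3 / 3)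
    + 2 * (1 + 4 / delta) ^+ N
      * expR (- (M%:R * delta ^+ 2 / 4) + M%:R * delta ^+ 3 / 3) in
  ((1 - R1 - R2)%:E <=
    P [set w : T | (1 + eps)^-1 - eps * Num.sqrt ((1 + eps) * N%:R / s%:R)
                 <= N%:R / s%:R ^+ 2 * \tr (proj l w *m proj k w)
                 <= 1 + eps * (1 + Num.sqrt ((1 + eps) * N%:R / s%:R))
                    + N%:R * eps ^+ 2 / (4 * s%:R)]%R)%E.

Proof.
pose proj (j : 'I_K) (w : T) : 'M[R]_N :=
  orth_proj (span_of (fun i => x i w) (J j)).
pose R1 : R := 2 * s%:R * expR ((1 + delta) * s%:R / 2
  - s%:R * (s%:R - 1) * (delta ^+ 2 / 2 - delta ^+ 3 / 3) / 2).
pose R2 : R := 2 * (M%:R + K%:R * (1 + 4 / delta) ^+ s)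
    * expR (- (N%:R * delta ^+ 2 / 4) + N%:R * delta ^+ 3 / 3)
  + 2 * (1 + 4 / delta) ^+ N
    * expR (- (M%:R * delta ^+ 2 / 4) + M%:R * delta ^+ 3 / 3).
pose lo : R := (1 + eps)^-1 - eps * Num.sqrt ((1 + eps) * N%:R / s%:R).
pose hi : R := 1 + eps * (1 + Num.sqrt ((1 + eps) * N%:R / s%:R))
  + N%:R * eps ^+ 2 / (4 * s%:R).
pose S := [set w : T | lo <= N%:R / s%:R ^+ 2 * \tr (proj l w *m proj k w) <= hi].
change ((1 - R1 - R2)%:E <= P S)%E.
have a0 : (0 : R) < N%:R by rewrite ltr0n.
have b0 : (0 : R) < s%:R by rewrite ltr0n.
have R1_ge0 : 0 <= R1 by rewrite /R1 !mulr_ge0 ?expR_ge0.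
have [R2_ge1|R2_lt1] := leP 1 R2.
  by apply: (@le_trans _ _ 0%E) => //; rewrite lee_fin; lra.
pose L := 1 + 4 / delta.
have L5 : 5 <= L by rewrite /L -lerBlDl ler_pdivlMr//; lra.
pose Q := expR (- (N%:R * delta ^+ 2 / 4) + N%:R * delta ^+ 3 / 3).
have Q0 : 0 < Q by exact: expR_gt0.
(* Taken from the summand of [R2] with factor $K \ge 1$; the other summands are nonnegative. *)
have LsQ : 2 * (L ^+ s * Q) <= R2.
  have K1 : (1 : R) <= K%:R by rewrite ler1n.
  have M0 : (0 : R) <= M%:R by [].
  have Ls0 : 0 <= L ^+ s by rewrite exprn_ge0//; lra.
  have LN0 : 0 <= 2 * L ^+ N * expR (- (M%:R * delta ^+ 2 / 4) + M%:R * delta ^+ 3 / 3).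
    by rewrite !mulr_ge0 ?expR_ge0 ?exprn_ge0//; lra.
  rewrite /R2 -/L -/Q; apply: ler_wpDr => //.
  rewrite mulrA ler_wpM2r ?(ltW Q0)// ler_wpM2l//.
  by apply: ler_wpDl => //; rewrite ler_peMl.
have R2_ge0 : 0 <= R2.
  by apply: le_trans LsQ; rewrite !mulr_ge0 ?exprn_ge0 ?(ltW Q0)//; lra.
have d3 : 0 < N%:R * delta ^+ 3 / 3 by rewrite divr_gt0// mulr_gt0// exprn_gt0.
(* As $e \le 4 < L$ and $L^sQ < 1$, also $e^sQ < 1$, that is $s < N\delta^2/4 - N\delta^3/3$. *)
have sN : s%:R <= N%:R * delta ^+ 2 / 4.
  have e5 : expR 1 <= L.
    apply: le_trans L5.
    have := expR_ge1Dx (- (1 / 2) : R); rewrite expRN => h.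
    have h2 : 1 / 2 * expR (1 / 2) <= 1 :> R.
      by rewrite -ler_pdivlMr ?expR_gt0// [_ / expR _]div1r; lra.
    have -> : expR 1 = expR (1 / 2) * expR (1 / 2) :> R.
      by rewrite -expRD; congr expR; field.
    have := expR_gt0 (1 / 2 : R); nra.
  have : expR (s%:R) * Q < 1.
    apply: le_lt_trans (_ : L ^+ s * Q < 1); last first.
      have : 0 < L ^+ s * Q by rewrite mulr_gt0// exprn_gt0//; lra.
      lra.
    rewrite ler_wpM2r ?(ltW Q0)// -[s%:R]mulr1 expRM_natl.
    by rewrite lerXn2r ?nnegrE ?expR_ge0//; lra.
  by rewrite /Q -expRD expR_lt1; lra.
have eps3 : 3 * delta <= eps by rewrite heps; nra.
have eps0 : 0 < eps by lra.
have sq0 : 0 <= Num.sqrt ((1 + eps) * N%:R / s%:R) by exact: sqrtr_ge0.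
(* By [sN] and $\delta \le \epsilon$, $\epsilon^2(1+\epsilon)N/s \ge 1$, while $(1+\epsilon)^{-1}
   \le 1$. *)
have lo0 : lo <= 0.
  pose X := (1 + eps) * N%:R / s%:R.
  have X1 : 1 <= eps ^+ 2 * X.
    rewrite /X mulrA ler_pdivlMr// mul1r; apply: (le_trans sN).
    have : delta ^+ 2 <= eps ^+ 2 by rewrite lerXn2r ?nnegrE//; lra.
    have : 0 <= eps ^+ 2 * N%:R * eps by rewrite !mulr_ge0 ?sqr_ge0 ?ltW.
    nra.
  have : 1 <= eps * Num.sqrt X.
    have -> : eps * Num.sqrt X = Num.sqrt (eps ^+ 2 * X).
      by rewrite [RHS]sqrtrM ?sqr_ge0// sqrtr_sqr gtr0_norm.
    by rewrite -[leLHS]sqrtr1 ler_sqrt// (le_trans ler01).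
  have : (1 + eps)^-1 <= 1 by rewrite invf_le1; lra.
  rewrite /lo -/X; lra.
have hi_ge : N%:R * eps ^+ 2 / (4 * s%:R) <= hi.
  by rewrite /hi lerDr addr_ge0// mulr_ge0//; lra.
pose G (j : 'I_K) w := gs_proj [seq (x i w : 'rV[R]_N) | i <- enum (J j)].
have projE j w : proj j w = G j w by exact: orth_proj_span_of.
have sizeJ j : size (enum (J j)) = s by rewrite -cardE hJcard.
pose tr w := \tr (G l w *m G k w).
have tr_bounds w : 0 <= tr w <= s%:R.
  have := mxtrace_proj_gs (G l w) [seq (x i w : 'rV[R]_N) | i <- enum (J k)]
    (is_orth_proj_gs _).
  by rewrite size_map sizeJ.
have c0 : 0 < N%:R / s%:R ^+ 2 :> R by rewrite divr_gt0// exprn_gt0.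
have lo_tr w : lo <= N%:R / s%:R ^+ 2 * tr w.
  by apply: (le_trans lo0); rewrite mulr_ge0 ?(ltW c0)//; case/andP: (tr_bounds w).
have cE (y : R) : N%:R / s%:R ^+ 2 * (s%:R * y) = N%:R / s%:R * y.
  by field; rewrite gt_eqF.
have [eps2|eps2] := leP 2 eps.
  rewrite (_ : S = setT) ?probability_setT ?lee_fin; first by lra.
  apply/seteqP; split => // w _; rewrite /S/= !projE -/(tr w) lo_tr/=.
  apply: le_trans hi_ge; apply: (@le_trans _ _ (N%:R / s%:R ^+ 2 * (s%:R * 1))).
    by rewrite ler_wpM2l ?(ltW c0)// mulr1; case/andP: (tr_bounds w).
  rewrite cE mulr1 invfM mulrA ler_wpM2r ?invr_ge0 ?(ltW b0)//.
  rewrite -mulrA ler_peMr ?(ltW a0)//; nra.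
(* Now $\epsilon < 2$, so $\tau \le 1/2$ and $\tau/(1-\tau) \le 2\tau = \epsilon^2/4$, which after
   scaling by $N/s$ is the last term of [hi]. *)
pose tau := eps ^+ 2 / 8.
have tau0 : 0 < tau by rewrite /tau divr_gt0// exprn_gt0.
have tau_half : tau <= 1 / 2 by rewrite /tau; nra.
have tau01 : 0 <= tau < 1 by rewrite ltW//=; lra.
have tau_eps : tau / (1 - tau) <= eps ^+ 2 / 4.
  rewrite ler_pdivrMr; last lra.
  by rewrite /tau in tau_half tau0 *; nra.
pose bad := [set w | (size (enum (J k)))%:R * (tau / (1 - tau)) < tr w].
have mtr : measurable_fun setT tr by exact: measurable_mxtrace_gs_proj.
have mbad : measurable bad.
  rewrite (_ : bad = tr @^-1` `]((size (enum (J k)))%:R * (tau / (1 - tau))), +oo[).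
    by rewrite -[X in measurable X]setTI; exact: mtr.
  by apply/seteqP; split => w; rewrite /bad/= in_itv/= andbT.
have Pbad : (P bad <= R2%:E)%E.
  have kl_disj i : i \in enum (J k) -> i \notin enum (J l).
    rewrite !mem_enum => ik; apply/negP => il.
    by have := finset.in_set0 i; rewrite -(hJdisj k l hkl) !inE ik il.
  apply: (le_trans (@mxtrace_proj_tail _ _ _ _ _ _ x hN hindep hunif tau s _ _ tau01
    (enum_uniq _) kl_disj _ _)); rewrite ?sizeJ//.
  rewrite lee_fin; apply: le_trans LsQ.
  rewrite mulrCA ler_wpM2l// mulrA.
  (* Since $\epsilon \ge 3\delta$, $N\epsilon^2/32 \ge 9N\delta^2/32 \ge N\delta^2/4$. *)
  have QQ : expR (- (N%:R * tau / 4)) <= Q.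
    rewrite /Q ler_expR /tau.
    have : (3 * delta) ^+ 2 <= eps ^+ 2 :> R by rewrite lerXn2r ?nnegrE//; lra.
    nra.
  apply: ler_pM; rewrite ?mulr_ge0 ?expR_ge0 ?exprn_ge0//.
  (* The bound $\epsilon < 2$ forces $\delta \le 1/2$; then $s\,4^s \le 2^s4^s = 8^s \le L^s$. *)
  have L8 : 8 <= L.
    have d3lt : (1 + delta) ^+ 3 < 3 by lra.
    have d12 : delta <= 1 / 2.
      rewrite leNgt; apply/negP => hd.
      have : (3 / 2) ^+ 3 <= (1 + delta) ^+ 3 by rewrite lerXn2r ?nnegrE//; lra.
      lra.
    by rewrite /L -lerBlDl ler_pdivlMr//; lra.
  apply: (@le_trans _ _ (8 ^+ s)); last by rewrite lerXn2r ?nnegrE//; lra.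
  rewrite (_ : 8 = 2 * 4 :> R) ?exprMn ?ler_wpM2r ?exprn_ge0//; last lra.
  by rewrite -natrX ler_nat ltnW// ltn_expl.
have goodS : ~` bad `<=` S.
  move=> w; rewrite /bad/= => /negP; rewrite -leNgt sizeJ => wtr.
  rewrite /S/= !projE -/(tr w) lo_tr/=; apply: le_trans hi_ge.
  apply: (le_trans (ler_wpM2l (ltW c0) wtr)); rewrite cE.
  have -> : N%:R * eps ^+ 2 / (4 * s%:R) = N%:R / s%:R * (eps ^+ 2 / 4).
    by field; rewrite gt_eqF.
  by rewrite ler_wpM2l// divr_ge0// ltW.
have mS : measurable S.
  rewrite (_ : S = (fun w => N%:R / s%:R ^+ 2 * tr w) @^-1` `[lo, hi]).
    by rewrite -[X in measurable X]setTI; apply: measurable_funM.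
  by apply/seteqP; split => w; rewrite /S/= in_itv/= !projE.
apply: (@le_trans _ _ (P (~` bad))); last first.
  by apply: le_measure; rewrite ?inE//; exact: measurableC.
rewrite probability_setC// leeBrDr ?fin_num_measure//.
apply: (@le_trans _ _ ((1 - R1 - R2)%:E + R2%:E)%E); first by rewrite leeD2l.
by rewrite -EFinD lee_fin; lra.
Qed.
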